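(* Let $n\ge 0$ and let $P$ be an $n$-dimensional polyhedron. Then there is a positive integer $m$ such that the cone over $P$ can be embedded in a product of $n+1$ copies of an $m$-od.
   Context: A polyhedron is the underlying space of a finite regular CW complex. An $m$-od is the cone over an $m$-element (discrete) set. *)

(* Defs.v *)
From HB Require Import structures.
From mathcomp Require Import all_boot all_order all_algebra generic_quotient.
From mathcomp Require Import all_classical all_reals all_analysis.
Import Order.TTheory GRing.Theory Num.Theory.
Import numFieldNormedType.Exports.

Set Implicit Arguments.
Unset Strict Implicit.
Unset Printing Implicit Defensive.

Local Open Scope classical_set_scope.
Local Open Scope ring_scope.
Local Open Scope quotient_scope.

(* Homeomorphism onto the image: the last condition says that [f] is open onto
   its image. *)
Definition embedding (X Y : topologicalType) (f : X -> Y) : Prop :=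
  [/\ continuous f, injective f &
    forall U : set X, open U -> exists2 V : set Y, open V &
      f @` U = V `&` range f].

(* The library norm on ['rV[R]_k] is the sup norm, hence the explicit sum of
   squares. The disk of dimension 0 is a point and its sphere is empty. *)
Definition sqnorm (R : realType) (k : nat) (v : 'rV[R]_k) : R :=
  \sum_(i < k) v ord0 i ^+ 2.

Definition disk (R : realType) (k : nat) : set 'rV[R]_k :=
  [set v | sqnorm v <= 1].
Arguments disk : clear implicits.

Definition disk_interior (R : realType) (k : nat) : set (disk R k) :=
  [set v | sqnorm (set_val v) < 1].
Arguments disk_interior : clear implicits.

Definition disk_boundary (R : realType) (k : nat) : set (disk R k) :=
  [set v | sqnorm (set_val v) = 1].
Arguments disk_boundary : clear implicits.

(* Finite regular CW structures on [X]: every closed cell is an embedded closed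
   disk. The weak topology axiom is automatic for finitely many cells. *)
Record finite_regular_cw (R : realType) (X : topologicalType) := FiniteRegularCW {
  cell : finType;
  cell_dim : cell -> nat;
  char_map : forall e : cell, disk R (cell_dim e) -> X;
  cw_hausdorff : hausdorff_space X;
  char_map_embedding : forall e : cell, embedding (@char_map e);
  open_cells_partition : forall x : X,
    exists! e : cell, (@char_map e @` disk_interior R (cell_dim e)) x;
  boundary_in_lower_cells : forall e : cell,
    @char_map e @` disk_boundary R (cell_dim e) `<=`
    \bigcup_(e' in [set e' : cell | (cell_dim e' < cell_dim e)%N])
      (@char_map e' @` disk_interior R (cell_dim e'))
}.

Definition cw_has_dim (R : realType) (X : topologicalType)
    (K : finite_regular_cw R X) (n : nat) : Prop :=
  (forall e : cell K, (cell_dim e <= n)%N) /\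
  (exists e : cell K, cell_dim e = n).

Definition polyhedron_of_dim (R : realType) (n : nat) (P : topologicalType)
    : Prop :=
  exists K : finite_regular_cw R P, cw_has_dim K n.

Definition unit_interval (R : realType) : set R := `[0, 1].
Arguments unit_interval : clear implicits.

Section Cone.
Variables (R : realType) (X : topologicalType).

Definition cone_rel_def (p q : X * unit_interval R) : bool :=
  (p == q) || ((set_val p.2 == 0) && (set_val q.2 == 0)).

Lemma cone_rel_refl : reflexive cone_rel_def.
Proof. by move=> p; rewrite /cone_rel_def eqxx. Qed.

Lemma cone_rel_sym : symmetric cone_rel_def.
Proof. by move=> p q; rewrite /cone_rel_def eq_sym andbC. Qed.

Lemma cone_rel_trans : transitive cone_rel_def.
Proof.
move=> q p r; rewrite /cone_rel_def.
case/predU1P => [->//|/andP[p0 q0]].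
by case/predU1P => [<-|/andP[_ r0]]; apply/orP; right; apply/andP.
Qed.

Definition cone_rel : equiv_rel (X * unit_interval R)%type :=
  EquivRel cone_rel_def cone_rel_refl cone_rel_sym cone_rel_trans.

(* [X * [0, 1]] with [X * {0}] collapsed to a point, in the quotient topology.
   For empty [X] this is empty rather than the one-point cone. *)
Definition cone : topologicalType := quotient_topology {eq_quot cone_rel}.

End Cone.

Definition m_od (R : realType) (m : nat) : topologicalType :=
  cone R (discrete_topology 'I_m).

(* Main.v *)
Require Import Defs.
From mathcomp Require Import all_boot all_order all_algebra generic_quotient.
From mathcomp Require Import all_classical all_reals all_analysis.
Import Order.TTheory GRing.Theory Num.Theory.
Import numFieldNormedType.Exports.

(** Let [K] be a finite regular CW structure on [P], of dimension [n].  The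
    proof builds continuous functions [weight _ e : P -> [0, 1]], one for each
    cell [e], which behave like the barycentric coordinates of the barycentric
    subdivision of [K]:
    - they sum to 1 ([sum_weight]);
    - at every point, at most one cell of each dimension has a nonzero weight
      ([weight_same_dim]);
    - together they separate points ([weight_inj]).
    Hence the cone over [P] maps to the product of [n + 1] cones over the finite
    set of cells: the [i]-th coordinate of the class of [(x, t)] lies on the leg
    of the cell [e] of dimension [i] with a nonzero weight at [x], at height
    [t * weight x e], or at the apex if there is no such cell.  The heights sum
    to [t] and, when [t <> 0], determine all the weights, hence [x]: the map is
    injective.  It is continuous, its source is compact and its target is
    Hausdorff, so it is an embedding.

    The weights are defined by coning in each cell.  If [x] is the image of [v]
    in the open disk of the cell [e], then [e] receives weight [1 - |v|^2] at
    [x], and the weights at the boundary point in the direction of [v],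
    multiplied by [|v|^2], are added ([weightE]).  That boundary point lies in
    an open cell of smaller dimension, so this is a recursion on the dimension
    ([carrier_ind]).  Injectivity of the weights uses that the characteristic
    maps are injective on closed disks, which is where regularity enters; it is
    not needed that closed cells are subcomplexes.  Continuity is also proved by
    induction on the dimension ([closed_weight]), [P] being a finite union of
    compact closed cells. *)

Set Implicit Arguments.
Unset Strict Implicit.
Unset Printing Implicit Defensive.

Local Open Scope classical_set_scope.
Local Open Scope ring_scope.
Local Open Scope quotient_scope.

(** * Compactness and embeddings *)

Lemma hausdorff_inj (X Y : topologicalType) (f : X -> Y) :
  continuous f -> injective f -> hausdorff_space Y -> hausdorff_space X.
Proof.
move=> cf fI hY p q clpq; apply/fI/hY => A B Afp Bfq.
by have [x [Ax Bx]] := clpq _ _ (cf p _ Afp) (cf q _ Bfq); exists (f x).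
Qed.

Lemma compact_set_type (X : topologicalType) (A : set X) :
  compact A -> compact [set: A].
Proof.
move=> cA F PF _.
have FA : (set_val @ F) A.
  by apply: (@filterE _ F) => x; exact: set_valP.
(* A cluster point in X of the image filter is one of F in the subtype. *)
have [p [Ap clp]] := cA _ (fmap_proper_filter _ PF) FA.
exists (exist _ p (mem_set Ap)); split => // B C FB.
case=> _ [/= [W oW <-] /= Wp WC].
have /(_ W)[||_ [[y By <-] Wy]] := clp (set_val @` B).
- by apply: (@filterS _ F _ B) => // y By; exists y.
- exact: open_nbhs_nbhs.
- by exists y; split => //; exact: WC.
Qed.

Lemma compact_embedding (X Y : topologicalType) (f : X -> Y) :
  compact [set: X] -> hausdorff_space Y -> continuous f -> injective f ->
  embedding f.
Proof.
move=> cX hY cf fI; split=> // U oU.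
exists (~` (f @` ~` U)).
  apply: closed_openC; apply: compact_closed => //.
  apply: continuous_compact; first exact: continuous_subspaceT.
  by apply: subclosed_compact cX _ => //; exact: open_closedC.
apply/seteqP; split=> [_ [x Ux <-]|y [fU [x _ xy]]].
  by split; [move=> [z nUz /fI zx]; apply: nUz; rewrite zx | exists x].
rewrite -{}xy in fU *; exists x => //; apply: contrapT => nUx.
by apply: fU; exists x.
Qed.

Lemma embedding_continuous_comp (X Y Z : topologicalType) (h : Y -> Z)
    (g : X -> Y) : embedding h -> continuous (h \o g) -> continuous g.
Proof.
case=> _ hI hop /continuousP chg; apply/continuousP => U /hop[V oV hUV].
rewrite (_ : g @^-1` U = (h \o g) @^-1` V); first exact: chg.
apply/seteqP; split=> x /= Ux.
  by have : (h @` U) (h (g x)); [exists (g x)|rewrite hUV => -[]].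
have : (V `&` range h) (h (g x)) by split; last exists (g x).
by rewrite -hUV => -[y Uy /hI <-].
Qed.

Lemma continuous_prod_topology (I : Type) (X : topologicalType)
    (Y : I -> topologicalType) (f : X -> prod_topology Y) :
  (forall i, continuous (fun x => f x i)) -> continuous f.
Proof.
move=> cf x; apply/cvg_sup => i.
exact: (@continuous_comp_initial _ _ _ (fun g : forall i, Y i => g i) f (cf i)).
Qed.

(** * Cones *)

Section ConeTheory.
Variables (R : realType) (X : topologicalType).
Let Q := quotient_topology {eq_quot (cone_rel R X)}.

(** The class of [(x, t)] in the cone. *)
Definition cone_pt (p : X * unit_interval R) : cone R X := \pi_Q p.

Lemma cone_pt_continuous : continuous cone_pt.
Proof. exact: (@pi_continuous _ {eq_quot (cone_rel R X)}). Qed.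

Lemma cone_pt_surj (q : cone R X) : exists p, cone_pt p = q.
Proof. by exists (repr (q : Q)); exact: (reprK (q : Q)). Qed.

Lemma cone_pt_eq p q : cone_pt p = cone_pt q <->
  p = q \/ set_val p.2 = 0 /\ set_val q.2 = 0.
Proof.
have -> : cone_pt p = cone_pt q <-> cone_rel_def p q.
  exact: (rwP (@eqmodP _ (cone_rel R X) p q)).
rewrite /cone_rel_def; split.
  by case/orP=> [/eqP->|/andP[/eqP-> /eqP->]]; [left|right].
by case=> [->|[-> ->]]; rewrite ?eqxx ?orbT.
Qed.

(** Universal property of the cone. *)
Lemma cone_lift (Z : topologicalType) (g : X * unit_interval R -> Z) :
  continuous g ->
  (forall p q, set_val p.2 = 0 -> set_val q.2 = 0 -> g p = g q) ->
  exists2 f : cone R X -> Z, continuous f & forall p, f (cone_pt p) = g p.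
Proof.
move=> cg g0.
have fE p : (g \o repr : Q -> Z) (cone_pt p) = g p.
  have : cone_pt (repr (cone_pt p : Q)) = cone_pt p.
    exact: (reprK (cone_pt p : Q)).
  by case/cone_pt_eq => [/= ->//|[p0 q0]]; exact: g0.
exists (g \o repr : Q -> Z) => //.
apply/quotient_continuous; rewrite (_ : _ \o _ = g) //.
by apply/funext => p; exact: fE.
Qed.

Lemma compact_cone : compact [set: X] -> compact [set: cone R X].
Proof.
move=> cX.
have -> : [set: cone R X] = cone_pt @` ([set: X] `*` [set: unit_interval R]).
  by apply/seteqP; split=> // q _; have [p <-] := cone_pt_surj q; exists p.
apply: continuous_compact; first exact/continuous_subspaceT/cone_pt_continuous.
apply: compact_setX => //; apply: compact_set_type; exact: segment_compact.
Qed.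

End ConeTheory.

(** The [m]-od embeds in [R^m] as the union of the unit segments of the
    coordinate axes. *)
Lemma m_od_embedding (R : realType) (m : nat) :
  exists2 h : m_od R m -> prod_topology (fun _ : 'I_m => R), embedding h &
    forall i t j, h (cone_pt (i, t)) j = (i == j)%:R * set_val t.
Proof.
pose g (p : discrete_topology 'I_m * unit_interval R) :
  prod_topology (fun _ : 'I_m => R) := fun j => (p.1 == j)%:R * set_val p.2.
have cd j : continuous (fun i : discrete_topology 'I_m => (i == j)%:R : R).
  by apply/continuousP => U _; exact: discrete_open.
have cg : continuous g.
  apply: continuous_prod_topology => j p; apply: cvgM.
    apply: (@continuous_comp _ _ _ fst
      (fun i : discrete_topology 'I_m => (i == j)%:R : R)).
      exact: cvg_fst.
    exact: cd.
  apply: (@continuous_comp _ _ _ snd (set_val : unit_interval R -> R)).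
    exact: cvg_snd.
  exact: initial_continuous.
have [|h ch hE] := cone_lift cg.
  by move=> p q p0 q0; apply/funext => j; rewrite /g p0 q0 !mulr0.
exists h => [|i t j]; last by rewrite hE.
apply: compact_embedding => //.
- apply/compact_cone/finite_compact; exact: (@finite_finset 'I_m).
- by apply: hausdorff_product => _; exact: Rhausdorff.
move=> p q; have [[i s] <-] := cone_pt_surj p.
have [[j t] <-] := cone_pt_surj q.
rewrite !hE => gE; apply/cone_pt_eq.
have /= := congr1 (fun u => u i) gE; have /= := congr1 (fun u => u j) gE.
rewrite /g /= !eqxx !mul1r; have [<-|ij] := eqVneq i j.
  by rewrite mul1r => /val_inj ->; left.
by rewrite !mul0r => <- ->; right.
Qed.

(** * The closed unit disk *)

Section Disk.
Variables (R : realType) (k : nat).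
Implicit Types v w : 'rV[R]_k.

Lemma sqnorm_ge0 v : 0 <= sqnorm v.
Proof. by apply: sumr_ge0 => i _; exact: sqr_ge0. Qed.

Lemma sqnorm_eq0 v : sqnorm v = 0 -> v = 0.
Proof.
move=> /eqP; rewrite psumr_eq0 => [/allP v0|i _]; last exact: sqr_ge0.
apply/rowP => i; rewrite mxE; apply/eqP; rewrite -sqrf_eq0.
by apply: v0; rewrite mem_index_enum.
Qed.

Lemma sqnorm_gt0 v : (0 < sqnorm v) = (v != 0).
Proof.
rewrite lt_neqAle sqnorm_ge0 andbT eq_sym; congr (~~ _).
apply/eqP/eqP => [|->]; first exact: sqnorm_eq0.
by apply: big1 => i _; rewrite mxE expr0n.
Qed.

Lemma sqnormZ a v : sqnorm (a *: v) = a ^+ 2 * sqnorm v.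
Proof. by rewrite mulr_sumr; apply: eq_bigr => i _; rewrite mxE exprMn. Qed.

Lemma sqnorm_continuous : continuous (@sqnorm R k).
Proof.
apply: continuous_big => [|i _ v]; first exact: add_continuous.
apply: (@continuous_comp _ _ _ (fun w : 'rV[R]_k => w ord0 i)
  (fun x : R => x ^+ 2)).
  exact: coord_continuous.
exact: exprn_continuous.
Qed.

Lemma compact_disk : compact (disk R k).
Proof.
apply: bounded_closed_compact; last first.
  have /continuous_closedP := sqnorm_continuous.
  by move=> /(_ `]-oo, 1]%classic (@closed_le _ 1)).
(* The norm on row vectors is the sup norm, at most the Euclidean one. *)
exists 1; split; first exact: real1.
move=> M M1 v v1 /=; rewrite [leLHS]/Num.norm /= mx_normrE; apply/bigmax_leP.
split=> [|[i j] _ /=]; first by apply/ltW/lt_trans/M1.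
apply: le_trans (ltW M1); rewrite ord1 -(@ler_pXn2r _ 2) ?nnegrE// expr1n.
rewrite real_normK ?num_real//; apply: le_trans v1.
by rewrite /sqnorm (bigD1 j)//= lerDl; apply: sumr_ge0 => ? _; exact: sqr_ge0.
Qed.

(** The unit vector [v / |v|]; it is [0] for [v = 0], because the inverse of
    [0] is [0]. *)
Definition unit_dir v : 'rV[R]_k := (Num.sqrt (sqnorm v))^-1 *: v.

Lemma sqnorm_unit_dir v : v != 0 -> sqnorm (unit_dir v) = 1.
Proof.
move=> v0; rewrite sqnormZ exprVn sqr_sqrtr ?sqnorm_ge0// mulVf//.
by apply: contra_neq v0; exact: sqnorm_eq0.
Qed.

Lemma unit_dirE v : v = Num.sqrt (sqnorm v) *: unit_dir v.
Proof.
have [->|v0] := eqVneq v 0; first by rewrite /unit_dir !scaler0.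
by rewrite scalerA divff ?scale1r// sqrtr_eq0 -ltNge sqnorm_gt0.
Qed.

Lemma unit_dir_disk v : disk R k (unit_dir v).
Proof.
have [->|/sqnorm_unit_dir v0] := eqVneq v 0; rewrite /disk /= ?v0//.
by rewrite /unit_dir scaler0 -(scale0r 0) sqnormZ expr0n mul0r.
Qed.

(** [unit_dir] as a map from the disk to itself: radial projection to the
    sphere, fixing the centre. *)
Definition dir (v : disk R k) : disk R k :=
  exist _ (unit_dir (set_val v)) (mem_set (unit_dir_disk (set_val v))).

Lemma dir_sphere (v : disk R k) : sqnorm (set_val v) = 1 -> dir v = v.
Proof.
by move=> v1; apply: val_inj; rewrite /= /unit_dir v1 sqrtr1 invr1 scale1r.
Qed.

Lemma dir_continuous (v : disk R k) : set_val v != 0 -> {for v, continuous dir}.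
Proof.
move=> v0.
suff cv : (set_val \o dir) u @[u --> v] --> set_val (dir v).
  move=> U [? [/= [W oW <-]]] /= Wv WU.
  apply: (@filterS _ (nbhs v) _ ((set_val \o dir) @^-1` W)) => [u Wu|].
    exact: WU.
  by apply: (cv W); exact: open_nbhs_nbhs.
have cval : (set_val u : 'rV[R]_k) @[u --> v] --> set_val v.
  exact: initial_continuous.
have cs : Num.sqrt (sqnorm (set_val u)) @[u --> v] -->
    Num.sqrt (sqnorm (set_val v)).
  apply: (@continuous_comp _ _ _ (fun u : disk R k => sqnorm (set_val u))
    Num.sqrt).
    apply: (@continuous_comp _ _ _ (set_val : disk R k -> _) (@sqnorm R k)).
      exact: cval.
    exact: sqnorm_continuous.
  exact: sqrt_continuous.
apply: (cvgZ (cvgV _ cs) cval).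
by rewrite sqrtr_eq0 -ltNge sqnorm_gt0.
Qed.

End Disk.

(** * Weights of the cells at a point *)

Section CellWeights.
Variables (R : realType) (P : topologicalType) (K : finite_regular_cw R P).
Implicit Types (x y : P) (e : cell K).

Let cmap e : disk R (cell_dim e) -> P := @char_map R P K e.

Lemma cmap_inj e : injective (@cmap e).
Proof. by have [] := char_map_embedding e. Qed.

Lemma cmap_continuous e : continuous (@cmap e).
Proof. by have [] := char_map_embedding e. Qed.

Lemma cell_coord_exists x :
  exists p : {e : cell K & disk R (cell_dim e)},
    sqnorm (set_val (projT2 p)) < 1 /\ cmap (projT2 p) = x.
Proof.
have [e [[v v1 vx] _]] := open_cells_partition K x.
by exists (existT _ e v).
Qed.

(** The open cell containing [x], and the coordinates of [x] in it. *)
Definition cell_coord x : {e : cell K & disk R (cell_dim e)} :=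
  projT1 (cid (cell_coord_exists x)).

(** The cell whose open cell contains [x]. *)
Definition carrier x : cell K := projT1 (cell_coord x).

(** The squared distance of [x] to the centre of its carrier, in the coordinates
    given by the characteristic map. *)
Definition radius2 x : R := sqnorm (set_val (projT2 (cell_coord x))).

(** The projection of [x] from the centre of its carrier to the boundary of the
    carrier; it is [x] itself when [x] is the centre. *)
Definition radial_proj x : P := cmap (dir (projT2 (cell_coord x))).

Lemma cmap_cell_coord x : cmap (projT2 (cell_coord x)) = x.
Proof. by rewrite /cell_coord; case: cid => ? []. Qed.

Lemma radius2_lt1 x : radius2 x < 1.
Proof. by rewrite /radius2 /cell_coord; case: cid => ? []. Qed.

Lemma radius2_ge0 x : 0 <= radius2 x. Proof. exact: sqnorm_ge0. Qed.

Lemma cell_coord_cmap e (v : disk R (cell_dim e)) :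
  sqnorm (set_val v) < 1 -> cell_coord (cmap v) = existT _ e v.
Proof.
move=> v1; have := cmap_cell_coord (cmap v); have := radius2_lt1 (cmap v).
rewrite /radius2; case: cell_coord => e' w /= w1 wv.
have [e0 [_ e0U]] := open_cells_partition K (cmap v).
have ee' : e' = e.
  rewrite -(e0U e'); last by exists w.
  by apply: e0U; exists v.
by subst e'; move/cmap_inj: wv => ->.
Qed.

Lemma carrier_cmap_sphere e (v : disk R (cell_dim e)) :
  sqnorm (set_val v) = 1 -> (cell_dim (carrier (cmap v)) < cell_dim e)%N.
Proof.
move=> v1.
have [|e' lee' [w w1 <-]] := @boundary_in_lower_cells _ _ K e (cmap v).
  by exists v.
by rewrite /carrier cell_coord_cmap.
Qed.

Lemma carrier_cmap_le e (v : disk R (cell_dim e)) :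
  (cell_dim (carrier (cmap v)) <= cell_dim e)%N.
Proof.
have := set_valP v; rewrite /disk /= le_eqVlt => /predU1P[v1|v1].
  exact/ltnW/carrier_cmap_sphere.
by rewrite /carrier cell_coord_cmap.
Qed.

Lemma carrier_cmap_dir e (v : disk R (cell_dim e)) : set_val v != 0 ->
  (cell_dim (carrier (cmap (dir v))) < cell_dim e)%N.
Proof. by move=> v0; apply/carrier_cmap_sphere/sqnorm_unit_dir. Qed.

Lemma carrier_radial_proj x : radius2 x != 0 ->
  (cell_dim (carrier (radial_proj x)) < cell_dim (carrier x))%N.
Proof.
by move=> x0; apply: carrier_cmap_dir; rewrite -sqnorm_gt0 lt0r x0 sqnorm_ge0.
Qed.

(** Induction from the boundary of a cell to its interior. *)
Lemma carrier_ind (Q : P -> Prop) :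
  (forall x, (radius2 x != 0 -> Q (radial_proj x)) -> Q x) -> forall x, Q x.
Proof.
move=> QI x; have [k] := ubnP (cell_dim (carrier x)).
elim: k x => // k IHk x xk; apply: QI => x0; apply: IHk.
exact: leq_trans (carrier_radial_proj x0) _.
Qed.

(** The first [k] steps of the recursion that defines the weights. *)
Fixpoint weight_rec k x e : R :=
  if k is k'.+1 then
    (e == carrier x)%:R * (1 - radius2 x) +
    radius2 x * weight_rec k' (radial_proj x) e
  else 0.

(** The weight of a cell at [x].  The recursion stops because the dimension of
    the carrier decreases from [x] to [radial_proj x], unless [radius2 x = 0],
    and then the recursive term vanishes. *)
Definition weight x : cell K -> R := weight_rec (cell_dim (carrier x)).+1 x.

Lemma weight_rec_stable k l x e :
  (cell_dim (carrier x) < k)%N -> (cell_dim (carrier x) < l)%N ->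
  weight_rec k x e = weight_rec l x e.
Proof.
elim: k l x => // k IHk [//|l] x xk xl /=; congr (_ + _).
have [->|x0] := eqVneq (radius2 x) 0; first by rewrite !mul0r.
have px := carrier_radial_proj x0; congr (_ * _).
by apply: IHk; exact: leq_trans px _.
Qed.

Lemma weightE x e :
  weight x e = (e == carrier x)%:R * (1 - radius2 x) +
    radius2 x * weight (radial_proj x) e.
Proof.
rewrite {1}/weight /=; congr (_ + _).
have [->|x0] := eqVneq (radius2 x) 0; first by rewrite !mul0r.
by congr (_ * _); apply: weight_rec_stable => //; exact: carrier_radial_proj.
Qed.

(** The recursion holds in the coordinates of any closed cell, including at the
    points of its boundary, where it is trivial. *)
Lemma weight_cmap e (v : disk R (cell_dim e)) e' :
  weight (cmap v) e' = (e' == e)%:R * (1 - sqnorm (set_val v)) +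
    sqnorm (set_val v) * weight (cmap (dir v)) e'.
Proof.
have := set_valP v; rewrite /disk /= le_eqVlt => /predU1P[v1|v1].
  by rewrite v1 subrr mulr0 add0r mul1r dir_sphere.
by rewrite weightE /carrier /radius2 /radial_proj cell_coord_cmap.
Qed.

Lemma weight_ge0 x e : 0 <= weight x e.
Proof.
elim/carrier_ind: x => x IHx; rewrite weightE addr_ge0//.
  by rewrite mulr_ge0// subr_ge0 ltW// radius2_lt1.
have [->|/IHx x0] := eqVneq (radius2 x) 0; first by rewrite mul0r.
by rewrite mulr_ge0// radius2_ge0.
Qed.

Lemma sum_weight x : \sum_e weight x e = 1.
Proof.
elim/carrier_ind: x => x IHx.
under eq_bigr do rewrite weightE.
rewrite big_split /= -mulr_sumr -mulr_suml (bigD1 (carrier x))//= eqxx.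
rewrite big1 => [|e /negbTE->//]; rewrite addr0 mul1r.
have [->|/IHx ->] := eqVneq (radius2 x) 0; first by rewrite mul0r subr0 addr0.
by rewrite mulr1 subrK.
Qed.

Lemma weight_le1 x e : weight x e <= 1.
Proof.
rewrite -(sum_weight x) (bigD1 e)//= lerDl; apply: sumr_ge0 => e' _.
exact: weight_ge0.
Qed.

Lemma weight_support x e : weight x e != 0 ->
  e = carrier x \/ (cell_dim e < cell_dim (carrier x))%N.
Proof.
elim/carrier_ind: x => x IHx; rewrite weightE.
have [->|_] := eqVneq e (carrier x); first by left.
rewrite mul0r add0r mulf_eq0 negb_or => /andP[x0 /(IHx x0)] xe; right.
have := carrier_radial_proj x0.
by case: xe => [->//|]; exact: ltn_trans.
Qed.

Lemma weight_carrier x : weight x (carrier x) = 1 - radius2 x.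
Proof.
rewrite weightE eqxx mul1r; apply/eqP; rewrite -subr_eq0 addrAC subrr add0r.
rewrite mulf_eq0; have [//|x0 /=] := eqVneq (radius2 x) 0.
have px := carrier_radial_proj x0.
by apply: contraTT px => /weight_support[<-|/ltnW]; rewrite -leqNgt.
Qed.

Lemma weight_same_dim x e e' : weight x e != 0 -> weight x e' != 0 ->
  cell_dim e = cell_dim e' -> e = e'.
Proof.
elim/carrier_ind: x => x IHx xe xe' ee'.
have [ex|ex] := weight_support xe; have [e'x|e'x] := weight_support xe'.
- by rewrite ex e'x.
- by move: e'x; rewrite -ee' ex ltnn.
- by move: ex; rewrite ee' e'x ltnn.
have aux e0 : (cell_dim e0 < cell_dim (carrier x))%N ->
    weight x e0 != 0 -> radius2 x != 0 /\ weight (radial_proj x) e0 != 0.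
  move=> e0x; rewrite weightE; have [e0E|_] := eqVneq e0 (carrier x).
    by rewrite e0E ltnn in e0x.
  by rewrite mul0r add0r mulf_eq0 negb_or => /andP[].
have [x0 pe] := aux _ ex xe; have [_ pe'] := aux _ e'x xe'.
exact: IHx.
Qed.

Lemma weight_inj x y : weight x =1 weight y -> x = y.
Proof.
elim/carrier_ind: x y => x IHx y wxy.
have nz z : weight z (carrier z) != 0.
  by rewrite weight_carrier subr_eq0 eq_sym lt_eqF// radius2_lt1.
(* Among the cells of nonzero weight at a point, the carrier has the largest
   dimension. *)
have exy : carrier x = carrier y.
  have : weight y (carrier x) != 0 by rewrite -wxy.
  have : weight x (carrier y) != 0 by rewrite wxy.
  move=> /weight_support[//|yx] /weight_support[//|/(ltn_trans yx)].
  by rewrite ltnn.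
(* The weight of the common carrier gives the radius. *)
have rxy : radius2 x = radius2 y.
  apply/oppr_inj/(addrI 1); rewrite -[LHS]weight_carrier -[RHS]weight_carrier.
  by rewrite -exy.
have pxy : radius2 x != 0 -> radial_proj x = radial_proj y.
  move=> x0; apply: IHx => // e.
  move: (wxy e); rewrite [LHS]weightE [RHS]weightE exy rxy => /addrI/mulfI.
  by apply; rewrite -rxy.
(* Equal radii and, off the centre, equal directions: this uses injectivity of
   the characteristic map on the boundary sphere. *)
rewrite -[LHS]cmap_cell_coord -[RHS]cmap_cell_coord; move: exy rxy pxy.
rewrite /carrier /radius2 /radial_proj.
case: (cell_coord x) (cell_coord y) => e v [e' w] /= ee'; subst e' => vw pvw.
suff vw_val : set_val v = set_val w by rewrite (val_inj vw_val).
have [v0|v0] := eqVneq (sqnorm (set_val v)) 0.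
  by rewrite (sqnorm_eq0 v0) (sqnorm_eq0 (etrans (esym vw) v0)).
have dvw : unit_dir (set_val v) = unit_dir (set_val w).
  by have /(congr1 set_val) := cmap_inj (pvw v0).
by rewrite [LHS]unit_dirE [RHS]unit_dirE vw dvw.
Qed.

(** If a weight is continuous, in the form that preimages of closed sets are
    closed, on the points with carrier of dimension less than [k], then it is
    continuous on every closed cell of dimension at most [k]. *)
Lemma weight_cmap_continuous e e' (k : nat) :
  (cell_dim e <= k)%N ->
  (forall Z : set R, closed Z ->
    closed [set x | (cell_dim (carrier x) < k)%N /\ Z (weight x e')]) ->
  continuous (fun v : disk R (cell_dim e) => weight (cmap v) e').
Proof.
move=> ek clk.
under eq_fun do rewrite weight_cmap.
move=> v.
have cs : sqnorm (set_val u : 'rV[R]_(cell_dim e)) @[u --> v] -->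
    sqnorm (set_val v).
  apply: (@continuous_comp _ _ _ (set_val : disk R _ -> _) (@sqnorm R _)).
    exact: initial_continuous.
  exact: sqnorm_continuous.
apply: (cvgD (cvgM (cvg_cst _) (cvgB (cvg_cst _) cs))).
(* The direction of v is discontinuous at 0, but there the factor |v|^2 tends
   to 0 and the weight is bounded. *)
have [v0|v0] := eqVneq (set_val v) 0.
  have s0 : sqnorm (set_val v) = 0.
    by apply/le_anti; rewrite sqnorm_ge0 andbT leNgt sqnorm_gt0 v0 eqxx.
  rewrite s0 mul0r; rewrite s0 in cs.
  apply: (squeeze_cvgr _ (cvg_cst 0) cs); apply: nearW => u.
  rewrite mulr_ge0 ?sqnorm_ge0 ?weight_ge0//=.
  by rewrite ler_piMr ?sqnorm_ge0// weight_le1.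
apply: (cvgM cs) => U; rewrite nbhsE => -[W [oW Wv] WU].
(* Near v, the radial projections avoid the closed set of the points with low
   dimensional carrier and weight outside W. *)
have := clk (~` W) (open_closedC oW); set B := [set x | _] => clB.
have nB : nbhs (cmap (dir v)) (~` B).
  by apply: open_nbhs_nbhs; split; [exact: closed_openC|case].
have near0 : \forall u \near v, set_val u != 0.
  have : \forall u \near v, 0 < sqnorm (set_val u).
    by apply: (cvgr_gt _ cs); rewrite sqnorm_gt0.
  by apply: filterS => u; rewrite sqnorm_gt0.
have nearB : \forall u \near v, (~` B) (cmap (dir u)).
  exact: (@continuous_comp _ _ _ (@dir R _) (@cmap e) v (dir_continuous v0)
    (@cmap_continuous e _) _ nB).
suff nearW : \forall u \near v, W (weight (cmap (dir u)) e').
  by apply: filterS nearW => u; exact: WU.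
apply: filterS2 near0 nearB => u u0 nBu; apply: contrapT => nW; apply: nBu.
by split=> //; apply: leq_trans ek; exact: carrier_cmap_dir.
Qed.

(** The set is a finite union of images of compact subsets of disks. *)
Lemma closed_weight k e' (Z : set R) : closed Z ->
  closed [set x | (cell_dim (carrier x) < k)%N /\ Z (weight x e')].
Proof.
elim: k Z => [|k IHk] Z clZ.
  rewrite (_ : mkset _ = set0); first exact: closed0.
  by apply/seteqP; split=> // x [].
rewrite (_ : mkset _ = \bigcup_(e in [set e | (cell_dim e < k.+1)%N])
   (@cmap e @` [set v | Z (weight (cmap v) e')])); last first.
  apply/seteqP; split=> [x [xk Zx]|x [e /= ek [v Zv <-]]].
    exists (carrier x) => //; exists (projT2 (cell_coord x)).
      by rewrite /= cmap_cell_coord.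
    exact: cmap_cell_coord.
  by split=> //; apply: leq_ltn_trans (carrier_cmap_le v) ek.
apply: closed_bigcup => [|e /= ek]; first exact: finite_finset.
apply: compact_closed; first exact: cw_hausdorff K.
apply: continuous_compact; first exact/continuous_subspaceT/cmap_continuous.
apply: subclosed_compact (compact_set_type (@compact_disk R _)) _ => //.
have /continuous_closedP := weight_cmap_continuous ek IHk.
exact.
Qed.

Lemma weight_continuous e : continuous (weight^~ e).
Proof.
apply/continuous_closedP => Z clZ.
have := @closed_weight (\max_(e' : cell K) cell_dim e').+1 e Z clZ.
set A := (X in closed X); suff -> : A = weight^~ e @^-1` Z by [].
apply/seteqP; split=> [x []//|x Zx]; split=> //.
by rewrite ltnS; exact: (leq_bigmax (carrier x)).
Qed.

Lemma compact_cw : compact [set: P].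
Proof.
have -> : [set: P] = \bigcup_e (@cmap e @` setT).
  apply/seteqP; split=> // x _; exists (carrier x) => //.
  by exists (projT2 (cell_coord x)) => //; exact: cmap_cell_coord.
rewrite -bigsetU_fset_set; last exact: finite_finset.
apply: bigsetU_compact => e _.
apply: continuous_compact; first exact/continuous_subspaceT/cmap_continuous.
exact/compact_set_type/compact_disk.
Qed.

End CellWeights.

(** * The map on the cone *)

Section ConeMap.
Variables (R : realType) (P : topologicalType) (K : finite_regular_cw R P).
Variable n : nat.
Local Notation m := #|cell K|.
Local Notation I := (unit_interval R).

Lemma scaled_weight_subproof (t : I) x (e : cell K) (b : bool) :
  unit_interval R (b%:R * (set_val t * weight x e)).
Proof.
have := set_valP t; rewrite /unit_interval /= !in_itv /= => /andP[t0 t1].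
have w0 := weight_ge0 x e; have w1 := weight_le1 x e.
by case: b; rewrite ?mul1r ?mul0r ?lexx ?ler01// mulr_ge0//= mulr_ile1.
Qed.

(** The height [t * weight x e], replaced by [0] when [b] is false. *)
Definition scaled_weight (t : I) x e b : I :=
  exist (fun s : R => s \in I) _ (mem_set (scaled_weight_subproof t x e b)).

Lemma scaled_weightE t x e b :
  set_val (scaled_weight t x e b) = b%:R * (set_val t * weight x e).
Proof. by []. Qed.

(** The cell of dimension [i] with a nonzero weight at [x].  If there is none,
    it is the carrier of [x], whose dimension is then not [i]. *)
Definition sel (i : 'I_n.+1) x : cell K :=
  odflt (carrier K x) [pick e | (cell_dim e == i) && (weight x e != 0)].

(** The [i]-th coordinate of the map, before passing to the cone over [P]; it is
    the apex when [sel] has found no cell of dimension [i]. *)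
Definition od_coord (i : 'I_n.+1) (p : P * I) : m_od R m :=
  let e := sel i p.1 in
  cone_pt (enum_rank e : discrete_topology 'I_m,
    scaled_weight p.2 p.1 e (cell_dim e == i)).

(** The height on the leg of [e] in the [i]-th coordinate: it is read off the
    weight of [e] alone, whichever leg [sel] picks. *)
Lemma sel_weight (i : 'I_n.+1) (t : R) x (e : cell K) :
  (sel i x == e)%:R * ((cell_dim (sel i x) == i)%:R * (t * weight x (sel i x)))
  = (cell_dim e == i)%:R * (t * weight x e).
Proof.
have [<-|ne] := eqVneq (sel i x) e; first by rewrite mul1r.
rewrite mul0r; have [ei|_] := eqVneq (cell_dim e) i; last by rewrite mul0r.
have [->|we] := eqVneq (weight x e) 0; first by rewrite !mulr0.
move: ne; rewrite /sel; case: pickP => [e' /andP[/eqP e'i we']|/(_ e)] /=.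
  by rewrite (weight_same_dim we' we) ?eqxx// ei.
by rewrite ei eqxx we.
Qed.

(** In the coordinates of [R^m], the [i]-th coordinate of the map no longer
    depends on a choice of a cell, hence its continuity. *)
Lemma embedded_od_coord (h : m_od R m -> prod_topology (fun _ : 'I_m => R))
    (hE : forall k t j, h (cone_pt (k, t)) j = (k == j)%:R * set_val t) i p e :
  h (od_coord i p) (enum_rank e)
  = (cell_dim e == i)%:R * (set_val p.2 * weight p.1 e).
Proof.
rewrite hE /= -sel_weight; congr (_ %:R * _).
by rewrite (inj_eq enum_rank_inj).
Qed.

Lemma od_coord_continuous i : continuous (od_coord i).
Proof.
have [h he hE] := m_od_embedding R m.
apply: (embedding_continuous_comp he); apply: continuous_prod_topology => j.
rewrite -(enum_valK j); move: (enum_val j) => e.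
under eq_fun do rewrite /= (embedded_od_coord hE).
move=> p.
have ct : set_val (q : P * I).2 @[q --> p] --> set_val p.2.
  apply: (@continuous_comp _ _ _ snd (set_val : I -> R)); first exact: cvg_snd.
  exact: initial_continuous.
have cw : weight (q : P * I).1 e @[q --> p] --> weight p.1 e.
  apply: (@continuous_comp _ _ _ fst (fun x => weight x e)).
    exact: cvg_fst.
  exact: weight_continuous.
exact: (cvgM (cvg_cst _) (cvgM ct cw)).
Qed.

(** The map to the product of the [m]-ods, before passing to the cone over
    [P]. *)
Definition od_map (p : P * I) : prod_topology (fun _ : 'I_n.+1 => m_od R m) :=
  fun i => od_coord i p.

Lemma od_map_continuous : continuous od_map.
Proof. exact/continuous_prod_topology/od_coord_continuous. Qed.

Hypothesis dimK : forall e : cell K, (cell_dim e <= n)%N.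

Lemma od_map_eq p q : od_map p = od_map q <->
  p = q \/ set_val p.2 = 0 /\ set_val q.2 = 0.
Proof.
split=> [pq|[->//|[p0 q0]]]; last first.
  apply/funext => i.
  apply/cone_pt_eq; right; split; rewrite [LHS]scaled_weightE.
    by rewrite p0 mul0r mulr0.
  by rewrite q0 mul0r mulr0.
have [h _ hE] := m_od_embedding R m.
have wpq (e : cell K) : set_val p.2 * weight p.1 e = set_val q.2 * weight q.1 e.
  have := congr1 (fun u => h (u (inord (cell_dim e))) (enum_rank e)) pq.
  by rewrite /od_map !(embedded_od_coord hE) inordK ?ltnS ?dimK// eqxx !mul1r.
(* The weights sum to 1, so the heights sum to t. *)
have tpq : set_val p.2 = set_val q.2.
  rewrite -[LHS]mulr1 -[RHS]mulr1 -{1}(sum_weight K p.1) -(sum_weight K q.1).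
  by rewrite !mulr_sumr; apply: eq_bigr => e _; exact: wpq.
have [p0|p0] := eqVneq (set_val p.2) 0; first by right; rewrite -tpq.
left; move: p q wpq tpq p0 {pq} => [x t] [y s] /= wpq ts t0.
have -> : s = t by exact/val_inj.
congr pair; apply: (@weight_inj _ _ K) => e.
by apply: (mulfI t0); rewrite wpq ts.
Qed.

End ConeMap.

Theorem theorem1p10 (R : realType) (n : nat) (P : topologicalType)
    (hP : polyhedron_of_dim R n P) :
  exists m : nat, (0 < m)%N /\
    exists f : cone R P -> prod_topology (fun _ : 'I_n.+1 => m_od R m),
      embedding f.
Proof.
have [K [dimK [e0 _]]] := hP.
exists #|cell K|; split; first by apply/card_gt0P; exists e0.
have [|f cf fE] := cone_lift (@od_map_continuous _ _ K n).
  by move=> p q p0 q0; apply/(od_map_eq dimK); right.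
exists f; apply: compact_embedding => //.
- exact/compact_cone/(compact_cw K).
- apply: hausdorff_product => _.
  have [h [ch hI _] _] := m_od_embedding R #|cell K|.
  apply: hausdorff_inj ch hI _; apply: hausdorff_product => _.
  exact: Rhausdorff.
move=> p q; have [{}p <-] := cone_pt_surj p; have [{}q <-] := cone_pt_surj q.
by rewrite !fE => /(od_map_eq dimK)/cone_pt_eq.
Qed.
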